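(* Among all 12-TET harmonic systems with thirds $(t,s)$, $11\ge t>s\ge 1$, and generator $q\equiv t+s\not\equiv 0\pmod{12}$, there are exactly twelve whose Levi graph $G(t,s)$ is isomorphic to $L_{12}(0,1,4)$, i.e. to the Levi graph of the standard Western system $(t,s)=(4,3)$, $q=7$. Among these twelve, exactly four have a generator $q$ with $\gcd(q,12)=1$, namely $(t,s)=(4,3)$ with $q=7$, $(t,s)=(9,4)$ with $q=1$, $(t,s)=(9,8)$ with $q=5$, and $(t,s)=(8,3)$ with $q=11$.
   Context: For a three-element subset (offset) $S\subset\mathbb{Z}_n$, the Levi graph $L_n(S)$ is the bipartite graph with vertices $P_0,\dots,P_{n-1}$ (points) and $L_0,\dots,L_{n-1}$ (lines), indices in $\mathbb{Z}_n$, and edges $P_i\sim L_{i+\sigma}$ for all $i\in\mathbb{Z}_n$, $\sigma\in S$; we write $L_n(a,b,c)=L_n(\{a,b,c\})$. An isomorphism of Levi graphs is a graph isomorphism which either maps points to points and lines to lines, or interchanges points and lines. A 12-TET harmonic system with generator $q$ and thirds $(t,s)$, $t+s\equiv q\pmod{12}$, has 12 Major chords $M_k=\{k,k+t,k+q\}$ and 12 minor chords $m_k=\{k,k+s,k+q\}$, $k\in\mathbb{Z}_{12}$, regarded as 24 distinct formal vertices. Its Levi graph $G(t,s)$ has these 24 vertices, and $M_k$ is adjacent to $m_k$, $m_{k+t}$ and $m_{k-s}$. Thus $G(t,s)=L_{12}(\{0,t,12-s\})$. Systems that differ only by interchanging $t$ and $s$ are identified; the convention $t>s$ selects one of the two.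 *)

(* Defs.v *)
(* MathComp *)
From mathcomp Require Import all_boot all_order all_algebra all_fingroup.

Set Implicit Arguments.
Unset Strict Implicit.
Unset Printing Implicit Defensive.

Import GRing.Theory.
Local Open Scope ring_scope.

(* inl i is the point P_i and inr j is the line L_j.
   'Z_n is the ring of integers mod n only for n > 1. *)
Definition levi_vertex (n : nat) : finType := ('Z_n + 'Z_n)%type.

Definition is_point (n : nat) (v : levi_vertex n) : bool :=
  if v is inl _ then true else false.

(* The Levi graph L_n(S); an offset S is meant to have three elements. *)
Definition levi (n : nat) (S : {set 'Z_n}) : rel (levi_vertex n) :=
  fun u v =>
    match u, v with
    | inl i, inr j | inr j, inl i => [exists sigma in S, j == i + sigma]
    | _, _ => false
    end.

Definition levi_iso (n : nat) (e1 e2 : rel (levi_vertex n)) : bool :=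
  [exists f : {perm levi_vertex n},
    [forall u, forall v, e2 (f u) (f v) == e1 u v]
    && ([forall v, is_point (f v) == is_point v]
        || [forall v, is_point (f v) == ~~ is_point v])].

Definition generator (ts : 'Z_12 * 'Z_12) : 'Z_12 := ts.1 + ts.2.

(* A pair of thirds (t, s), given by representatives in {0, ..., 11}, with
   11 >= t > s >= 1 compared as natural numbers, and t + s nonzero mod 12. *)
Definition harmonic_system (ts : 'Z_12 * 'Z_12) : bool :=
  [&& (1 <= ts.2)%N, (ts.2 < ts.1)%N & generator ts != 0].

(* The Levi graph G(t, s): the point inl k is the Major chord
   M_k = {k, k + t, k + q} and the line inr k is the minor chord
   m_k = {k, k + s, k + q}, as formal vertices. *)
Definition harmonic_graph (ts : 'Z_12 * 'Z_12) : rel (levi_vertex 12) :=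
  let: (t, s) := ts in
  fun u v =>
    match u, v with
    | inl k, inr l | inr l, inl k => l \in [set k; k + t; k - s]
    | _, _ => false
    end.

Lemma harmonic_graphE (t s : 'Z_12) :
  harmonic_graph (t, s) =2 levi [set 0; t; - s].
Proof.
suff E k l : (l \in [set k; k + t; k - s])
           = [exists sigma in [set 0; t; - s], l == k + sigma :> 'Z_12].
  by move=> [k|l] [k'|l'] //=; rewrite E.
apply/idP/existsP => [|[x]].
  rewrite !inE => /orP[/orP[]|] /eqP ->;
    [exists 0|exists t|exists (- s)]; by rewrite !inE ?addr0 !eqxx ?orbT.
rewrite !inE => /andP[/orP[/orP[]|] /eqP -> /eqP ->];
  by rewrite ?addr0 eqxx ?orbT.
Qed.

(* Main.v *)
Require Import Defs.
From mathcomp Require Import all_boot all_order all_algebra all_fingroup.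
Import GRing.Theory.
Local Open Scope ring_scope.

(** Two mechanisms settle every harmonic system.

    If an affine map [x |-> u * x + w] with [u] a unit carries the offset [S]
    onto the offset [T], then [P_i |-> P_{u i}], [L_j |-> L_{u j + w}] is an
    isomorphism of [L_n(S)] onto [L_n(T)] ([levi_iso_affine]).  For twelve of
    the systems the offset [{0, t, -s}] is affinely equivalent to [{0, 1, 4}].

    Any graph isomorphism preserves the number of closed walks of given length
    at a vertex ([closed_walks_iso]).  In [L_12(0,1,4)] there are 697 closed
    walks of length 8 at every vertex ([closed_walks_western]), while no other
    harmonic system has this number of them at [P_0]
    ([western_dichotomy]).  Length 8 is the shortest that works: up to length 6
    the graph [L_12(0,1,5)] has as many closed walks as [L_12(0,1,4)], but at
    length 8 it has 699.

    Hence the Western class is an explicit list of twelve pairs, from which the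
    remaining claims are read off. *)

(** * Closed walks as an isomorphism invariant *)

(** The endpoints of the walks of length [k] from [u], listed with
    multiplicity; working with lists makes the counts computable. *)
Definition walk_ends {T : Type} (nb : T -> seq T) (k : nat) (u : T) : seq T :=
  iter k (fun s => flatten (map nb s)) [:: u].

Definition closed_walks {T : eqType} (nb : T -> seq T) (k : nat) (u : T) :
    nat :=
  count_mem u (walk_ends nb k u).

Definition adjacency_list {T : eqType} (nb : T -> seq T) (e : rel T) : Prop :=
  forall u, uniq (nb u) /\ e u =i nb u.

Lemma walk_ends_map {T U : eqType} {nb1 : T -> seq T} {nb2 : U -> seq U}
    {f : T -> U} :
  (forall u, perm_eq (nb2 (f u)) (map f (nb1 u))) ->
  forall k u, perm_eq (walk_ends nb2 k (f u)) (map f (walk_ends nb1 k u)).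
Proof.
move=> nbf; elim=> [|k IHk] u //=.
apply: perm_trans (perm_flatten (perm_map nb2 (IHk u))) _.
rewrite map_flatten -!map_comp.
by elim: (walk_ends nb1 k u) => //= v s IHs; apply: perm_cat (nbf v) IHs.
Qed.

Lemma closed_walks_iso {T : finType} {e1 e2 : rel T} {nb1 nb2 : T -> seq T}
    (f : {perm T}) :
  adjacency_list nb1 e1 -> adjacency_list nb2 e2 ->
  (forall u v, e2 (f u) (f v) = e1 u v) ->
  forall k u, closed_walks nb2 k (f u) = closed_walks nb1 k u.
Proof.
move=> adj1 adj2 isof k u.
have nbf v : perm_eq (nb2 (f v)) (map f (nb1 v)).
  have [uniq1 mem1] := adj1 v; have [uniq2 mem2] := adj2 (f v).
  apply: uniq_perm => // [|w]; first by rewrite (map_inj_uniq perm_inj).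
  rewrite -[w](permKV f) (mem_map perm_inj) -mem1 -mem2.
  exact: isof.
rewrite /closed_walks (seq.permP (walk_ends_map nbf k u)) count_map.
by apply: eq_count => v /=; rewrite (inj_eq perm_inj).
Qed.

(** * Levi graphs *)

Definition levi_nbrs {n : nat} (S : seq 'Z_n) (v : levi_vertex n) :
    seq (levi_vertex n) :=
  match v with
  | inl i => [seq inr (i + x) | x <- S]
  | inr j => [seq inl (j - x) | x <- S]
  end.

Lemma levi_nbrsP {n : nat} {A : {set 'Z_n}} {S : seq 'Z_n} :
  uniq S -> A =i S -> adjacency_list (levi_nbrs S) (levi A).
Proof.
move=> uniqS AS [i|j]; split.
(* [inl] and [inr] are stripped by explicit views: [case] would also inject
   through the ordinals and leave an equation between residues. *)
- by rewrite map_inj_uniq // => x y /(@inr_inj _ _ _ _)/(addrI i).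
- case=> [i'|j]; first by apply/esym/negP => /mapP[].
  apply/exists_inP/mapP
    => [[x xA /eqP ->]|[x xS /(@inr_inj _ _ _ _) ->]]; exists x => //.
    by rewrite -AS.
  by rewrite AS.
- by rewrite map_inj_uniq // => x y /(@inl_inj _ _ _ _)/(addrI j)/oppr_inj.
- case=> [i|j']; last by apply/esym/negP => /mapP[].
  apply/exists_inP/mapP
    => [[x xA /eqP ->]|[x xS /(@inl_inj _ _ _ _) ->]]; exists x => //.
  + by rewrite -AS.
  + by rewrite addrK.
  + by rewrite AS.
  + by rewrite subrK.
Qed.

Lemma levi_iso_affine {n : nat} (A B : {set 'Z_n}) (u w : 'Z_n) :
  u \is a GRing.unit -> B = [set u * x + w | x in A] ->
  levi_iso (levi A) (levi B).
Proof.
move=> uU ->.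
pose f (v : levi_vertex n) : levi_vertex n :=
  match v with inl i => inl (u * i) | inr j => inr (u * j + w) end.
have injf : injective f.
  move=> [i|j] [i'|j'] //= => [/(@inl_inj _ _ _ _)|/(@inr_inj _ _ _ _)/addIr];
    by move/(mulrI uU) ->.
have edge i j : [exists x in [set u * x + w | x in A], u * j + w == u * i + x]
    = [exists x in A, j == i + x].
  apply/exists_inP/exists_inP => [[_ /imsetP[x xA ->]]|[x xA /eqP ->]].
    rewrite addrA -mulrDr => /eqP/addIr/(mulrI uU) ->.
    by exists x.
  by exists (u * x + w); [apply: imset_f | rewrite mulrDr addrA].
apply/existsP; exists (perm injf); apply/andP; split.
  by apply/'forall_forallP => -[i|j] [i'|j']; rewrite !permE //= edge.
by apply/orP; left; apply/forallP => -[i|j]; rewrite permE.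
Qed.

Lemma eq_levi_iso {n : nat} (e1 e1' e2 : rel (levi_vertex n)) :
  e1 =2 e1' -> levi_iso e1 e2 = levi_iso e1' e2.
Proof.
move=> eq_e; apply: eq_existsb => f; congr (_ && _).
by apply: eq_forallb => u; apply: eq_forallb => v; rewrite eq_e.
Qed.

(** * The harmonic systems *)

(** An enumeration of [Z_12] that reduces, unlike [enum], so that statements
    about all pitch classes can be evaluated. *)
Definition Z12 : seq 'Z_12 := [seq inZp k | k <- iota 0 12].

Lemma mem_Z12 (x : 'Z_12) : x \in Z12.
Proof.
apply/mapP; exists (x : nat); last by rewrite valZpK.
by rewrite mem_iota /= ltn_ord.
Qed.

Definition western_offset : seq 'Z_12 := [:: 0; 1; 4].

Definition harmonic_offset (ts : 'Z_12 * 'Z_12) : seq 'Z_12 :=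
  [:: 0; ts.1; - ts.2].

(** The four systems whose generator is a unit come first. *)
Definition western_systems : seq ('Z_12 * 'Z_12) :=
  [:: (4, 3); (9, 4); (9, 8); (8, 3);
      (3, 1); (5, 3); (5, 4); (8, 1); (8, 7); (9, 7); (11, 4); (11, 9)].

Definition western_affine (ts : 'Z_12 * 'Z_12) : bool :=
  has (fun u => (u \is a GRing.unit) &&
    has (fun w => perm_eq western_offset
                    [seq u * x + w | x <- harmonic_offset ts]) Z12) Z12.

(** All vertices are covered because an isomorphism may send [P_0] of the other
    graph to any point or line. *)
Lemma closed_walks_western (v : levi_vertex 12) :
  closed_walks (levi_nbrs western_offset) 8 v = 697%N.
Proof.
have /allP H : all (fun i =>
    (closed_walks (levi_nbrs western_offset) 8 (inl i) == 697%N) &&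
    (closed_walks (levi_nbrs western_offset) 8 (inr i) == 697%N)) Z12.
  by vm_compute.
by case: v => i; have /andP[P L] := H i (mem_Z12 i);
  [exact/eqP/P | exact/eqP/L].
Qed.

(** On the systems outside the list, distinctness of the three offsets is
    recorded as well, since only then do the lists [levi_nbrs] count edges
    without repetition. *)
Lemma western_dichotomy (ts : 'Z_12 * 'Z_12) :
  harmonic_system ts ->
  if ts \in western_systems then western_affine ts
  else uniq (harmonic_offset ts) &&
    (closed_walks (levi_nbrs (harmonic_offset ts)) 8 (inl 0) != 697%N).
Proof.
move=> harm_ts.
suff /allP H : all (fun ts : 'Z_12 * 'Z_12 =>
    if ts \in western_systems then western_affine ts
    else uniq (harmonic_offset ts) &&
      (closed_walks (levi_nbrs (harmonic_offset ts)) 8 (inl 0) != 697%N))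
    [seq ts <- [seq (t, s) | t <- Z12, s <- Z12] | harmonic_system ts].
  apply: H; rewrite mem_filter harm_ts.
  by case: ts {harm_ts} => t s; apply: allpairs_f; apply: mem_Z12.
by vm_compute.
Qed.

(** * The Western class *)

Lemma mem_western (ts : 'Z_12 * 'Z_12) :
  (ts \in [set ts | harmonic_system ts
             & levi_iso (harmonic_graph ts) (@levi 12 [set 0; 1; 4])])
  = (ts \in western_systems).
Proof.
case: ts => t s; rewrite inE /= (eq_levi_iso _ _ _ (harmonic_graphE t s)).
have memA : [set 0; t; - s] =i harmonic_offset (t, s).
  by move=> x; rewrite !inE orbA.
have memB : [set 0; 1; 4] =i western_offset by move=> x; rewrite !inE orbA.
have /allP harmonic_western : all harmonic_system western_systems.
  by vm_compute.
case: (boolP (harmonic_system (t, s))) => [harm|nharm] /=; last first.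
  by apply/esym; apply: contraNF nharm => /harmonic_western.
have := western_dichotomy (t, s) harm; case: ifP => _.
  case/hasP=> u _ /andP[uU /hasP[w _ /perm_mem affine_w]].
  apply: levi_iso_affine uU _.
  apply/setP => y; rewrite memB affine_w.
  apply/mapP/imsetP => -[x xS ->]; exists x => //; first by rewrite memA.
  by rewrite -memA.
case/andP=> uniqA neq; apply: contraNF neq.
case/existsP=> f /andP[/'forall_'forall_eqP isof _].
have adjA := levi_nbrsP uniqA memA.
have adjB := levi_nbrsP (isT : uniq western_offset) memB.
by rewrite -(closed_walks_iso f adjA adjB isof) closed_walks_western.
Qed.

Theorem mainTheorem2 :
  let western : {set 'Z_12 * 'Z_12} :=
    [set ts | harmonic_system ts
              & levi_iso (harmonic_graph ts) (@levi 12 [set 0; 1; 4])] in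
  [/\ levi_iso (harmonic_graph (4, 3)) (@levi 12 [set 0; 1; 4]),
      #|western| = 12%N,
      #|[set ts in western | coprime (generator ts) 12]| = 4%N
    & [set (ts, generator ts) | ts in western & coprime (generator ts) 12]
      = [set ((4, 3), 7); ((9, 4), 1); ((9, 8), 5); ((8, 3), 11)]].
Proof.
move=> western.
have mem_w ts : (ts \in western) = (ts \in western_systems).
  exact: mem_western.
pose tonal := [seq ts <- western_systems | coprime (generator ts) 12].
have tonalE : tonal = [:: (4, 3); (9, 4); (9, 8); (8, 3)] by vm_compute.
have mem_tonal ts :
    (ts \in western) && coprime (generator ts) 12 = (ts \in tonal).
  by rewrite mem_filter andbC mem_w.
clearbody tonal; split.
- have: (4, 3) \in western by rewrite mem_w.
  by rewrite inE => /andP[].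
- rewrite (eq_card mem_w); exact/card_uniqP.
- rewrite (eq_card (B := mem tonal)) => [|ts]; last by rewrite inE mem_tonal.
  by rewrite tonalE; apply/card_uniqP.
- apply/setP => x.
  transitivity (x \in [seq (ts, generator ts) | ts <- tonal]).
    apply/imsetP/mapP => -[ts tsP ->]; (exists ts; last exact: erefl);
      by move: tsP; rewrite inE mem_tonal.
  have -> : [seq (ts, generator ts) | ts <- tonal]
      = [:: ((4, 3), 7); ((9, 4), 1); ((9, 8), 5); ((8, 3), 11)].
    (* Only the boolean equality evaluates: the residues computed by [generator]
       and the literals carry different bound proofs. *)
    by rewrite tonalE; apply/eqP; vm_compute.
  by rewrite !in_cons in_nil orbF !in_setU !in_set1 !orbA.
Qed.
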